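(* Let $n \ge 1$ and let $P(\lambda) = I\lambda^2 + U_1\lambda + U_0$ be an $n\times n$ matrix polynomial, where $U_0, U_1 \in M_n(\mathbb{C})$ are unitary matrices with $U_0U_1 = U_1U_0$. Then the corresponding $2n\times 2n$ block companion matrix $C = \begin{bmatrix} 0 & I \\ -U_0 & -U_1\end{bmatrix}$ of $P(\lambda)$ is diagonalizable (over $\mathbb{C}$).
   Context: $M_n(\mathbb{C})$ is the space of $n\times n$ complex matrices; $I$ and $0$ denote the $n\times n$ identity and zero matrices. *)

(* Defs.v *)
From HB Require Import structures.
From mathcomp Require Import all_boot all_order all_algebra.
From mathcomp Require Import reals complex.

Set Implicit Arguments.
Unset Strict Implicit.
Unset Printing Implicit Defensive.

Import GRing.Theory.
Local Open Scope ring_scope.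

(* Only meaningful for a monic matrix polynomial P of degree 2. The dimension
   is a successor because MathComp has polynomials only over nonzero rings. *)
Definition block_companion (K : nzRingType) (n : nat) (P : {poly 'M[K]_n.+1}) :
    'M[K]_(n.+1 + n.+1) :=
  block_mx 0 1%:M (- P`_0) (- P`_1).

(* Main.v *)
Require Import Defs.
From HB Require Import structures.
From mathcomp Require Import all_boot all_order all_algebra.
From mathcomp Require Import reals complex ring.

Set Implicit Arguments.
Unset Strict Implicit.
Unset Printing Implicit Defensive.

Import Order.TTheory GRing.Theory Num.Theory.
Local Open Scope ring_scope.

(** U0 and U1 are normal and commute, so they are simultaneously diagonalizable
    and P splits into scalar quadratics x^2 + b x + c with |b| = |c| = 1. A
    double root would force b^2 = 4 c, which the moduli exclude; hence each
    quadratic has two distinct roots, and each of them extends a common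
    eigenvector of U0 and U1 to an eigenvector of the companion matrix. *)

Lemma unitarymx_normal (C : numClosedFieldType) n (U : 'M[C]_n) :
  U \is unitarymx -> U \is normalmx.
Proof.
move=> Uu; apply/normalmxP.
by rewrite (unitarymxP Uu) -invmx_unitary // mulVmx // unitarymx_unit.
Qed.

Lemma unitarymx_diagonalizable (C : numClosedFieldType) n (U : 'M[C]_n) :
  U \is unitarymx -> diagonalizable U.
Proof.
move=> /unitarymx_normal/orthomx_spectralP ->.
exists (spectralmx U); first exact: spectral_unit.
apply/similar_diagPex; exists (spectral_diag U).
apply/similarLR; first exact: spectral_unit.
by rewrite conjVmx ?spectral_unit.
Qed.

(** Multiplication by [U] preserves [dotmx], whereas on an eigenvector [v] it scales [dotmx v v] by
    [|a|^2]. *)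
Lemma unitarymx_eigenvalue_norm (C : numClosedFieldType) n (U : 'M[C]_n) a :
  U \is unitarymx -> eigenvalue U a -> `|a| = 1.
Proof.
move=> /unitarymxP Uu /eigenvalueP[v vU v_neq0].
have vv_neq0 : dotmx v v != 0 by rewrite dnorm_eq0.
have : dotmx (v *m U) (v *m U) = dotmx v v.
  rewrite !dotmxE trmx_mul map_mxM mulmxA.
  by rewrite -[v *m U *m _]mulmxA Uu mulmx1.
rewrite vU linearZl_LR linearZr_LR /= mulrA -[RHS]mul1r.
move=> /(mulIf vv_neq0); rewrite -normCK => /eqP.
by rewrite sqrp_eq1 // => /eqP.
Qed.

(** The quadratic formula: the two roots differ by the square root [s] of the discriminant. Their
    sum and product are all that is used later. *)
Lemma quadratic_distinct_roots (C : numClosedFieldType) (b c : C) :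
  b ^+ 2 != 4 * c ->
  exists z : C * C, [/\ z.1 + z.2 = - b, z.1 * z.2 = c & z.1 != z.2].
Proof.
move=> disc; pose s := sqrtC (b ^+ 2 - 4 * c).
have s2 : s ^+ 2 = b ^+ 2 - 4 * c by rewrite sqrtCK.
have s_neq0 : s != 0 by rewrite sqrtC_eq0 subr_eq0.
exists ((- b + s) / 2, (- b - s) / 2); split => /=; first by field.
  have -> : (- b + s) / 2 * ((- b - s) / 2) = (b ^+ 2 - s ^+ 2) / 4 by field.
  by rewrite s2; field.
rewrite -subr_eq0; suff -> : (- b + s) / 2 - (- b - s) / 2 = s by [].
by field.
Qed.

(* If y is a left eigenvector of A0 and A1 with eigenvalues c and b, and z, z'
   are the roots of x^2 + b x + c, then (- z' y, y) is a left eigenvector of the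
   companion matrix for z, since z + b = - z'. *)
Lemma quadratic_companion_diagonalizable (C : numClosedFieldType) n
    (A0 A1 P : 'M[C]_n) (d0 d1 : 'rV[C]_n) :
    P \in unitmx -> similar P A0 (diag_mx d0) -> similar P A1 (diag_mx d1) ->
    (forall i, d1 0 i ^+ 2 != 4 * d0 0 i) ->
  diagonalizable (block_mx 0 1%:M (- A0) (- A1)).
Proof.
move=> Pu /(similarP Pu) PA0 /(similarP Pu) PA1 disc.
have /fin_all_exists[z zP] i := quadratic_distinct_roots (disc i).
pose a := \row_i (z i).1; pose b := \row_i (z i).2.
(* The blocks of [T] are commuting diagonal matrices, so [T] is inverted like a 2 by 2 matrix of
   determinant [a - b], which [e] inverts entrywise; [T'] is that inverse. *)
pose e := \row_i ((z i).1 - (z i).2)^-1.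
pose T := block_mx (- diag_mx b) 1%:M (- diag_mx a) 1%:M.
pose T' := block_mx (diag_mx e) (- diag_mx e)
                    (diag_mx a *m diag_mx e) (- (diag_mx b *m diag_mx e)).
have abD : diag_mx a + diag_mx b = - diag_mx d1.
  rewrite -raddfD -raddfN /=; congr diag_mx; apply/rowP => i; rewrite !mxE.
  by have [] := zP i.
have abM : diag_mx a *m diag_mx b = diag_mx d0.
  rewrite mulmx_diag; congr diag_mx; apply/rowP => i; rewrite !mxE.
  by have [] := zP i.
have abV : (diag_mx a - diag_mx b) *m diag_mx e = 1%:M.
  rewrite -raddfB /= mulmx_diag -diag_const_mx; congr diag_mx; apply/rowP => i.
  by rewrite !mxE mulfV // subr_eq0; have [] := zP i.
have Tu : T \in unitmx.
  suff /mulmx1_unit[] : T *m T' = 1%:M by [].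
  rewrite mulmx_block !mul1mx !mulmxN !mulNmx !opprK !subrr.
  by rewrite addNr [- _ + _]addrC -!mulmxBl abV -scalar_mx_block.
(* The rows of [Q] are the eigenvectors [(- b_i y, y)] and [(- a_i y, y)], for [y] the [i]-th row of
   [P]; their eigenvalues are [a_i] and [b_i]. *)
pose Q := T *m block_mx P 0 0 P.
have Qu : Q \in unitmx.
  rewrite unitmx_mul Tu unitmxE det_ublock unitrM -unitmxE.
  by rewrite Pu.
exists Q => //; apply/similar_diagPex; exists (row_mx a b).
apply/similarP => //.
rewrite /Q /T !mulmx_block diag_mx_row !mulmx_block.
rewrite !(mulmx0, mul0mx, mul1mx, mulmx1, addr0, add0r) !mulmxN !mulNmx.
(* Vieta's relations [d0 = a b] and [- d1 = a + b] now make both block rows agree. *)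
rewrite PA0 PA1 !mulmxN !mulmxA -abM [diag_mx b *m diag_mx a]diag_mxC.
rewrite -![- (diag_mx d1 *m P)]mulNmx -abD mulmxDl.
by rewrite addKr addrC addrK.
Qed.

Lemma block_companion_quadratic (K : nzRingType) n (A0 A1 : 'M[K]_n.+1) :
  block_companion (1%:M *: 'X^2 + A1 *: 'X + A0%:P) =
    block_mx 0 1%:M (- A0) (- A1).
Proof.
by rewrite /block_companion !coefE /= !mulr0 !mulr1 !add0r addr0.
Qed.

Theorem theorem2p4 (R : realType) (n : nat) (U0 U1 : 'M[R[i]]_n.+1)
    (P : {poly 'M[R[i]]_n.+1})
    (hP : P = 1%:M *: 'X^2 + U1 *: 'X + U0%:P)
    (hU0 : U0 \is unitarymx) (hU1 : U1 \is unitarymx)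
    (hcomm : U0 *m U1 = U1 *m U0) :
  diagonalizable (block_companion P).
Proof.
rewrite hP block_companion_quadratic.
have [Q Qu /allP QD] : codiagonalizable [:: U0; U1].
  apply/codiagonalizableP; split=> [A B|A]; rewrite !inE.
    by do 2![case/orP=> /eqP->]; rewrite /comm_mx ?hcomm.
  by case/orP=> /eqP->; apply: unitarymx_diagonalizable.
have /similar_diagPex[d0 s0] := QD _ (mem_head _ _).
have /similar_diagPex[d1 s1] : similar_diag Q U1.
  by apply: QD; rewrite !inE eqxx orbT.
(* Row [i] of [Q] is an eigenvector of [U] for [d 0 i], nonzero because [Q] is invertible. *)
have norm1 U d i : U \is unitarymx -> similar Q U (diag_mx d) -> `|d 0 i| = 1.
  move=> Uu /(similarP Qu) QU; apply: (unitarymx_eigenvalue_norm Uu).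
  apply/eigenvalueP; exists (row i Q).
    by rewrite -row_mul QU row_mul row_diag_mx -scalemxAl -rowE.
  rewrite rowE mulmx_free_eq0 ?row_free_unit //.
  by apply/eqP => /rowP/(_ i)/eqP; rewrite !mxE !eqxx oner_eq0.
apply: (quadratic_companion_diagonalizable Qu s0 s1) => i.
(* Taking moduli in [b^2 = 4 c] would give [1 = 4]. *)
apply/eqP => /(congr1 Num.norm).
rewrite normrX normrM (norm1 _ _ _ hU1 s1) (norm1 _ _ _ hU0 s0).
by rewrite expr1n mulr1 normr_nat => /esym/eqP; rewrite pnatr_eq1.
Qed.
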